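(* Let $n$ be a positive integer, let $\omega_n=\exp(-2\pi i/n)$, and let $\mathbf{U}$ be the $n\times n$ unitary discrete Fourier transform matrix, whose entry in row $j$ and column $k$ is $\frac{1}{\sqrt{n}}\,\omega_n^{(j-1)(k-1)}$ for $j,k=1,\ldots,n$. Then $\mathbf{U}$ is a symmetric unitary matrix, so that $\mathbf{U}^{-1}=\mathbf{U}^*=\overline{\mathbf{U}}^{\mathrm{T}}=\overline{\mathbf{U}}$, and for all $a,t\in\mathbb{R}$ the matrix $\mathbf{M}=\mathbf{M}(a,t)=(a-t)\cdot\mathbf{I}_{n\times n}+t\cdot\mathbf{1}_{n\times n}$ satisfies $$\mathbf{M}=\mathbf{U}\boldsymbol{\Lambda}\overline{\mathbf{U}}=\overline{\mathbf{U}}\boldsymbol{\Lambda}\mathbf{U},\qquad \boldsymbol{\Lambda}\equiv\mathrm{diag}(\lambda_{**},\lambda_*,\ldots,\lambda_* ),$$ where $\lambda_{**}=a-t+nt$ (appearing once, in the first diagonal position) and $\lambda_*=a-t$ (appearing in the remaining $n-1$ diagonal positions).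
   Context: $\mathbf{I}_{n\times n}$ is the $n\times n$ identity matrix and $\mathbf{1}_{n\times n}$ is the $n\times n$ matrix all of whose entries equal $1$. The matrix $\mathbf{M}(a,t)$, called the double-constant matrix, has every diagonal entry equal to $a$ and every off-diagonal entry equal to $t$. The bar denotes the entrywise complex conjugate of a matrix, $\mathrm{T}$ the transpose, and $\mathbf{U}^*$ the conjugate transpose. *)

(* Defs.v *)
From mathcomp Require Export all_boot all_order all_algebra.
From mathcomp Require Export complex.
From mathcomp Require Export reals sequences exp trigo.

Set Implicit Arguments.
Unset Strict Implicit.
Unset Printing Implicit Defensive.

Import Order.TTheory GRing.Theory Num.Theory.
Local Open Scope ring_scope.
Local Open Scope complex_scope.

(* exp (x + i y) = e^x (cos y + i sin y), for x and y real *)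
Definition cexp (R : realType) (z : R[i]) : R[i] :=
  (expR (complex.Re z))%:C * (cos (complex.Im z) +i* sin (complex.Im z)).

Definition dft_omega (R : realType) (n : nat) : R[i] :=
  cexp (- 2 * pi%:C * 'i / n%:R).

(* Rows and columns are numbered from 0, hence the exponent [j * k] in place of
   (j - 1)(k - 1). *)
Definition dft_mx (R : realType) (n : nat) : 'M[R[i]]_n :=
  \matrix_(j < n, k < n) (1 / (Num.sqrt n%:R)%:C * dft_omega R n ^+ (j * k)).

Definition double_const_mx (R : Type) (n : nat) (a t : R) : 'M[R]_n :=
  \matrix_(i < n, j < n) (if i == j then a else t).

(* Main.v *)
Require Import Defs.
From mathcomp Require Import ring lra.
Import Order.TTheory GRing.Theory Num.Theory.
Local Open Scope ring_scope.
Local Open Scope complex_scope.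
Local Open Scope sesquilinear_scope.

(** [omega_n] is a primitive [n]-th root of unity of modulus 1, so the product
    of row [j] of [U] with row [k] of its conjugate is a geometric sum of ratio
    [omega_n ^ (j - k)], whence unitarity.  Moreover
    [Lambda = (a - t) I + n t E_00], and the first column of [U] is constant
    equal to [1 / sqrt n], so that [U E_00 Ubar] is [1 / n] times the all-ones
    matrix. *)

Lemma de_moivre (R : realType) (x : R) (k : nat) :
  (cos x +i* sin x) ^+ k = cos (x *+ k) +i* sin (x *+ k).
Proof.
elim: k => [|k IHk]; first by rewrite mulr0n cos0 sin0 expr0.
by rewrite exprS IHk mulrS cosD sinD; congr (_ +i* _); rewrite addrC.
Qed.

(** Half-angle argument: [cos x] equals [1 - 2 sin(x/2)^2], and for [0 < x < 2 pi] the half-angle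
    lies in [(0, pi)], where the sine is positive. *)
Lemma cos_eq1_lt2pi (R : realType) (x : R) :
  0 <= x < pi *+ 2 -> cos x = 1 -> x = 0.
Proof.
move=> /andP[x_ge0 x_lt] cosx1; apply: contra_eq (cosx1) => x_neq0.
have x_gt0 : 0 < x by rewrite lt0r x_neq0.
have sin_half : 0 < sin (x / 2) by apply: sin_gt0_pi; apply/andP; split; lra.
have xE : x = (x / 2) *+ 2 by rewrite -mulr_natr divfK ?pnatr_eq0.
rewrite xE cos_mulr2n; have := cos2Dsin2 (x / 2).
by move: (exprn_gt0 2 sin_half) => ? ?; rewrite lt_eqF //; lra.
Qed.

Lemma dft_omegaE (R : realType) (n : nat) : (0 < n)%N ->
  dft_omega R n = cos (- (pi *+ 2 / n%:R)) +i* sin (- (pi *+ 2 / n%:R)).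
Proof.
move=> n_gt0; rewrite /dft_omega.
have -> : - 2 * pi%:C * 'i%R / n%:R = 0 +i* (- (pi *+ 2 / n%:R)) :> R[i].
  rewrite -complexiE -[n%:R](rmorph_nat (real_complex R)) -fmorphV /=.
  rewrite -[2](rmorph_nat (real_complex R)) -rmorphN -rmorphM /=.
  by simpc; congr (_ +i* _); ring.
by rewrite /cexp /= expR0 mul1r.
Qed.

(** By de Moivre, the power [i.+1] has angle [2 pi (i.+1) / n] up to sign. For [i.+1 < n] this lies
    strictly between 0 and [2 pi], so its cosine is not 1; for [i.+1 = n] it is a full turn. *)
Lemma dft_omega_prim (R : realType) (n : nat) :
  (0 < n)%N -> n.-primitive_root (dft_omega R n).
Proof.
move=> n_gt0; have nR_gt0 : 0 < n%:R :> R by rewrite ltr0n.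
apply/andP; split => //; apply/forallP => i.
rewrite unity_rootE dft_omegaE // de_moivre eq_complex /=.
rewrite !mulNrn cosN sinN oppr_eq0.
have [->|i_neq] := eqVneq i.+1 n.
  rewrite -[_ / _ *+ n]mulr_natr divfK ?lt0r_neq0 // cos2pi.
  by rewrite sin_mulr2n sinpi mulr0 mul0rn !eqxx.
apply/eqP/negbTE/negP => /andP[/eqP cos1 _].
have i_lt : (i.+1 < n)%N by rewrite ltn_neqAle i_neq ltn_ord.
have pi2_gt0 : 0 < pi *+ 2 :> R by rewrite pmulrn_lgt0 ?pi_gt0.
have angle_gt0 : 0 < pi *+ 2 / n%:R *+ i.+1 :> R.
  by rewrite pmulrn_lgt0 ?divr_gt0.
suff /eqP : pi *+ 2 / n%:R *+ i.+1 = 0 :> R by rewrite gt_eqF.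
apply: cos_eq1_lt2pi cos1; rewrite (ltW angle_gt0) -[_ / _ *+ _]mulr_natr.
by rewrite mulrAC ltr_pdivrMr // ltr_pM2l ?ltr_nat.
Qed.

(** The inverse is the conjugate divided by the squared modulus, which is 1 here. *)
Lemma conj_dft_omega (R : realType) (n : nat) :
  (0 < n)%N -> (dft_omega R n)^*%R = (dft_omega R n)^-1.
Proof.
move=> n_gt0; rewrite invC_norm dft_omegaE // normc_def /= cos2Dsin2 sqrtr1.
by rewrite expr1n invr1 mul1r.
Qed.

(** Let [q] be the ratio [z ^+ j / z ^+ l]. If [q = 1], all [n] terms are 1; otherwise
    [q ^+ n - 1 = 0] factors as [q - 1] times the sum, which must vanish. *)
Lemma sum_prim_root (F : fieldType) (n : nat) (z : F) (j l : nat) :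
  n.-primitive_root z ->
  \sum_(k < n) (z ^+ j / z ^+ l) ^+ k = (n * (j == l %[mod n]))%:R.
Proof.
move=> z_prim; have zl_neq0 : z ^+ l != 0.
  by rewrite expf_neq0 // (prim_root_eq0 z_prim) -lt0n (prim_order_gt0 z_prim).
have q1E : (z ^+ j / z ^+ l == 1) = (j == l %[mod n]).
  by rewrite -(eq_prim_root_expr z_prim) -subr_eq0 -[RHS]subr_eq0
    -[LHS](mulIr_eq0 _ (mulIf zl_neq0)) mulrBl divfK // mul1r.
rewrite -q1E; case: eqP => [->|/eqP q_neq1].
  rewrite (eq_bigr (fun=> 1)) => [|k _]; last by rewrite expr1n.
  by rewrite sumr_const card_ord muln1.
have := subrX1 (z ^+ j / z ^+ l) n.
rewrite exprMn exprVn !(exprAC _ _ n) (prim_expr_order z_prim) !expr1n divr1.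
by move=> /esym/eqP; rewrite subrr mulf_eq0 subr_eq0 (negbTE q_neq1) muln0 => /eqP.
Qed.

Lemma dft_mx_sym (R : realType) (n : nat) : (dft_mx R n)^T = dft_mx R n.
Proof. by apply/matrixP => i j; rewrite !mxE mulnC. Qed.

Lemma conj_real_complex (R : rcfType) (x : R) : (x%:C)^*%R = x%:C :> R[i].
Proof. exact: conjc_real. Qed.

Lemma inv_sqrt_natC_conj (R : realType) (n : nat) :
  (1 / (Num.sqrt n%:R)%:C) * (1 / (Num.sqrt n%:R)%:C)^*%R = n%:R^-1 :> R[i].
Proof.
rewrite !div1r fmorphV /= conj_real_complex -invfM -rmorphM /= -expr2 sqr_sqrtr ?ler0n //.
by rewrite rmorph_nat.
Qed.

Lemma dft_mx_unitary (R : realType) (n : nat) :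
  (0 < n)%N -> dft_mx R n \is unitarymx.
Proof.
move=> n_gt0; apply/unitarymxP/matrixP => j l; rewrite !mxE.
set w := dft_omega R n.
rewrite (eq_bigr (fun k : 'I_n => n%:R^-1 * (w ^+ j / w ^+ l) ^+ k)) => [|k _].
  rewrite -mulr_sumr (sum_prim_root _ _ _ _ _ (dft_omega_prim _ _ n_gt0)).
  (* Both indices are below [n], so congruence modulo [n] is equality and the sum is an entry of the
     identity. *)
  rewrite !modn_small // natrM mulrA mulVf ?mul1r //.
  by rewrite pnatr_eq0 -lt0n.
rewrite !mxE rmorphM rmorphXn /= conj_dft_omega // mulrACA inv_sqrt_natC_conj.
by rewrite !exprM (exprMn k (w ^+ j)) !exprVn.
Qed.

Lemma dft_mx_delta (R : realType) (n : nat) :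
  dft_mx R n.+1 *m delta_mx 0 0 *m map_mx Num.conj (dft_mx R n.+1)
  = n.+1%:R^-1 *: const_mx 1.
Proof.
(* [E_00] splits as a column times a row, making the product the outer product of the first column
   of [U] and the first row of its conjugate. *)
rewrite -(mul_delta_mx (0 : 'I_1)) mulmxA -colE -mulmxA -rowE.
apply/matrixP => i j; rewrite !mxE big_ord1 !mxE muln0 mul0n expr0 !mulr1.
exact: inv_sqrt_natC_conj.
Qed.

Lemma double_const_mxE (R : nzRingType) (n : nat) (a t : R) :
  double_const_mx n a t = (a - t) *: 1%:M + t *: const_mx 1.
Proof.
apply/matrixP => i j; rewrite !mxE mulr1.
by case: eqP => _; rewrite ?mulr1 ?subrK ?mulr0 ?add0r.
Qed.

Lemma double_const_mx_dft (R : realType) (n : nat) (a t : R) : (0 < n)%N ->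
  map_mx (real_complex R) (double_const_mx n a t) =
  dft_mx R n
  *m diag_mx (\row_(j < n)
       (if j == 0%N :> nat then a - t + n%:R * t else a - t)%:C)
  *m map_mx Num.conj (dft_mx R n).
Proof.
case: n => // n _; set U := dft_mx _ _.
have -> : diag_mx (\row_(j < n.+1)
    (if j == 0%N :> nat then a - t + n.+1%:R * t else a - t)%:C)
    = (a - t)%:C%:M + (n.+1%:R * t)%:C *: delta_mx 0 0 :> 'M[R[i]]_n.+1.
  apply/matrixP => i j; rewrite !mxE.
  have [<-|ij_neq] := eqVneq i j; last first.
    rewrite (_ : (i == 0) && (j == 0) = false) ?mulr0 ?addr0 //.
    by apply: contraNF ij_neq => /andP[/eqP-> /eqP->].
  rewrite andbb -val_eqE /=; case: eqP => _; last by rewrite mulr0 addr0.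
  by rewrite mulr1 !mulr1n rmorphD.
(* By symmetry of [U], unitarity reads [U Ubar = 1], which handles the scalar part of [Lambda]. *)
have /unitarymxP := dft_mx_unitary R n.+1 (ltn0Sn n).
rewrite -/U dft_mx_sym => UU1.
rewrite mulmxDr mulmxDl mul_mx_scalar -scalemxAl UU1 -scalemxAr -scalemxAl.
rewrite dft_mx_delta scalerA double_const_mxE map_mxD !map_mxZ map_mx1.
rewrite map_const_mx rmorph1 rmorphM rmorph_nat mulrAC mulfV ?mul1r //.
by rewrite pnatr_eq0.
Qed.

Theorem theorem3 (R : realType) (n : nat) (n_gt0 : (0 < n)%N) :
  let U : 'M[R[i]]_n := dft_mx R n in
  let Ubar : 'M[R[i]]_n := map_mx Num.conj U in
  [/\ U \is symmetricmx, U \is unitarymx & U \in unitmx]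
  /\ [/\ invmx U = U^t*, U^t* = Ubar^T & Ubar^T = Ubar]
  /\ forall a t : R,
       let M : 'M[R]_n := double_const_mx n a t in
       let lambda2 : R := a - t + n%:R * t in
       let lambda1 : R := a - t in
       let Lambda : 'M[R[i]]_n :=
         diag_mx (\row_(j < n) (if j == 0%N :> nat then lambda2 else lambda1)%:C) in
       [/\ M = (a - t) *: 1%:M + t *: const_mx 1,
           map_mx (real_complex R) M = U *m Lambda *m Ubar
         & map_mx (real_complex R) M = Ubar *m Lambda *m U].
Proof.
move=> U Ubar; have U_unitary := dft_mx_unitary R n n_gt0.
split; [split | split; [split|]] => //.
(* [symmetricmx] is the hermitian predicate with trivial sign and the identity as automorphism. *)
- by apply/is_hermitianmxP; rewrite expr0 scale1r map_mx_id // dft_mx_sym.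
- exact: unitarymx_unit.
- exact: invmx_unitary.
- by rewrite map_trmx.
- by rewrite map_trmx dft_mx_sym.
move=> a t M lambda2 lambda1 Lambda.
have MU := double_const_mx_dft R n a t n_gt0.
split=> //; first exact: double_const_mxE.
(* [M] and [Lambda] are real, so conjugating the first factorization entrywise swaps [U] and [Ubar]
   and yields the second. *)
have conj_real m p (A : 'M[R]_(m, p)) :
    map_mx Num.conj (map_mx (real_complex R) A) = map_mx (real_complex R) A.
  by apply/matrixP => i j; rewrite !mxE /= conj_real_complex.
have conjLambda : map_mx Num.conj Lambda = Lambda.
  rewrite map_diag_mx; congr diag_mx.
  by apply/rowP => j; rewrite !mxE /= conj_real_complex.
rewrite -conj_real [map_mx (real_complex R) M]MU !map_mxM conjLambda.
congr (_ *m _); apply/matrixP => i j; rewrite !mxE.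
exact: conjCK.
Qed.
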